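(* Let $V$ be a vector space over a field $k$ and let $\varphi\in\mathrm{End}_k(V)$ be a finite potent endomorphism of index $m$. Then there exists a bijection $$X_\varphi(GD1)\;\simeq\;\prod_{\substack{s_i\in S_{\mu_i(U_\varphi,\varphi)}\\ 1\le i\le m}}\Big[(V/\ker\varphi)\times\prod_{j=1}^{i-1}\ker\varphi\Big].$$
   Context: $k$ is an arbitrary field, $V$ an arbitrary (possibly infinite-dimensional) $k$-vector space. An endomorphism $\varphi\in\mathrm{End}_k(V)$ is finite potent if $\varphi^n(V)$ is finite dimensional for some $n\ge 1$. For such $\varphi$ there is a unique $\varphi$-invariant decomposition $V=W_\varphi\oplus U_\varphi$ (the AST decomposition) with $W_\varphi$ finite dimensional, $\varphi|_{W_\varphi}$ an automorphism of $W_\varphi$, and $\varphi|_{U_\varphi}$ nilpotent; the index $i(\varphi)$ is the nilpotency order of $\varphi|_{U_\varphi}$ ($i(\varphi)=0$ iff $V$ is finite dimensional and $\varphi$ is an automorphism). A $\{1\}$-inverse of $\varphi$ is $\varphi^-\in\mathrm{End}_k(V)$ with $\varphi\varphi^-\varphi=\varphi$; the set of them is $X_\varphi(1)$. A G-Drazin inverse of $\varphi$ is $\varphi^{GD}\in\mathrm{End}_k(V)$ with $\varphi\varphi^{GD}\varphi=\varphi$ and $\varphi^{GD}\varphi^m=\varphi^m\varphi^{GD}$, where $m=i(\varphi)$; the set of them is $X_\varphi(GD)$. $X_\varphi(GD1)$ is the set of GD1 inverses of $\varphi$, i.e. of $\psi\in\mathrm{End}_k(V)$ such that $\psi\varphi\psi=\psi$,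 $\psi\varphi=\varphi^{GD}\varphi$ and $\varphi\psi=\varphi\varphi^-$ for some $\varphi^-\in X_\varphi(1)$ and $\varphi^{GD}\in X_\varphi(GD)$. Index sets: writing $g=\varphi|_{U_\varphi}$ (nilpotent on $U_\varphi$), for $1\le i\le m$ let $\mu_i(U_\varphi,\varphi)=\dim_k\big(\ker g^i/[\ker g^{i-1}+g(\ker g^{i+1})]\big)$ (possibly an infinite cardinal), and let $S_{\mu_i(U_\varphi,\varphi)}$ be a set of cardinality $\mu_i(U_\varphi,\varphi)$, these sets being pairwise disjoint for different $i$. (So $S_{\mu_i(U_\varphi,\varphi)}$ indexes the Jordan chains of length $i$ in a Jordan basis of $U_\varphi$ for $\varphi|_{U_\varphi}$.) The outer product runs over all $i\in\{1,\dots,m\}$ and all $s_i\in S_{\mu_i(U_\varphi,\varphi)}$; ''bijection'' means bijection of sets. *)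

(* Defs.v *)
From HB Require Import structures.
From mathcomp Require Import all_boot all_algebra.
From mathcomp Require Import boolp classical_sets functions cardinality.

Set Implicit Arguments.
Unset Strict Implicit.
Unset Printing Implicit Defensive.

Import GRing.Theory.
Local Open Scope ring_scope.
Local Open Scope classical_set_scope.
Local Open Scope card_scope.
Local Open Scope quotient_scope.

(* Subspaces of V are the library's [submodClosed V]. That structure is set up
   over semirings and does not inherit from [zmodClosed], hence [zmodpred]. *)

Section SubmodZmod.
Variables (k : fieldType) (V : lmodType k) (A : submodClosed V).

Fact submodB : {in A &, forall u v, u - v \in A}.
Proof. by move=> u v uA vA; rewrite rpredD// -scaleN1r rpredZ. Qed.

Definition zmodpred : {pred V} := A.
Fact zmodpred_closed : zmod_closed zmodpred.
Proof. by split; [exact: rpred0|exact: submodB]. Qed.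
HB.instance Definition _ := GRing.isZmodClosed.Build V zmodpred zmodpred_closed.

End SubmodZmod.

Section Subspaces.
Variables (k : fieldType) (V : lmodType k).
Implicit Types (f : {linear V -> V}) (A B : submodClosed V).

Fact iter_is_linear n f : linear (iter n f).
Proof. by move=> a u v; elim: n => //= n ->; rewrite linearP. Qed.
HB.instance Definition _ n f :=
  GRing.isLinear.Build k V V *:%R (iter n f) (iter_is_linear n f).

Definition kermod f : {pred V} := [pred v | f v == 0].
Fact kermod_submod_closed f : submod_closed (kermod f).
Proof.
split=> [|a u v]; rewrite !inE ?linear0// linearP => /eqP-> /eqP->.
by rewrite scaler0 addr0.
Qed.
HB.instance Definition _ f :=
  GRing.isSubmodClosed.Build k V (kermod f) (kermod_submod_closed f).

Definition immod f A : {pred V} := [pred v | v \in f @` [set` A]].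
Fact immod_submod_closed f A : submod_closed (immod f A).
Proof.
split=> [|a u v]; rewrite !inE /=; first by exists 0; rewrite /= ?rpred0 ?linear0.
move=> [x xA <-] [y yA <-]; exists (a *: x + y); last by rewrite linearP.
by rewrite /= rpredD ?rpredZ.
Qed.
HB.instance Definition _ f A :=
  GRing.isSubmodClosed.Build k V (immod f A) (immod_submod_closed f A).

Definition capmod A B : {pred V} := [predI A & B].
Fact capmod_submod_closed A B : submod_closed (capmod A B).
Proof.
split=> [|a u v]; rewrite !inE ?rpred0//.
by move=> /andP[uA uB] /andP[vA vB]; rewrite !rpredD ?rpredZ.
Qed.
HB.instance Definition _ A B :=
  GRing.isSubmodClosed.Build k V (capmod A B) (capmod_submod_closed A B).

Definition addmod A B : {pred V} :=
  [pred v | `[< exists a b, [/\ a \in A, b \in B & v = a + b] >]].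
Fact addmod_submod_closed A B : submod_closed (addmod A B).
Proof.
split=> [|c u v]; rewrite !inE.
  by exists 0, 0; split; rewrite ?rpred0 ?addr0.
move=> [a [b [aA bB ->]]] [a' [b' [aA' bB' ->]]]; exists (c *: a + a'), (c *: b + b').
by split; rewrite ?rpredD ?rpredZ// scalerDr addrACA.
Qed.
HB.instance Definition _ A B :=
  GRing.isSubmodClosed.Build k V (addmod A B) (addmod_submod_closed A B).

End Subspaces.

(* The library only provides the additive group structure on [Quotient.quot A]. *)

Section Quotient.
Variables (k : fieldType) (V : lmodType k) (A : submodClosed V).

Definition quotmod := Quotient.quot (zmodpred A).
HB.instance Definition _ := GRing.Zmodule.on quotmod.
HB.instance Definition _ : EqQuotient V (Quotient.equiv (zmodpred A)) quotmod :=
  EqQuotient.on quotmod.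

Definition quotmod_scale (a : k) (x : quotmod) : quotmod :=
  \pi_quotmod (a *: repr x).

Lemma quotmod_eq (u v : V) : (\pi_quotmod u = \pi_quotmod v) <-> u - v \in A.
Proof.
rewrite -[_ \in A]/(u - v \in zmodpred A) Quotient.idealrBE.
by split=> /eqP.
Qed.

Fact quotmod_piD (u v : V) :
  \pi_quotmod (u + v) = \pi_quotmod u + \pi_quotmod v.
Proof. exact: (Quotient.pi_add (zmodpred A)). Qed.

Fact quotmod_piZ a (u : V) :
  \pi_quotmod (a *: u) = quotmod_scale a (\pi_quotmod u).
Proof.
apply/quotmod_eq; rewrite -scalerBr rpredZ//.
by apply/quotmod_eq; rewrite reprK.
Qed.

Fact quotmod_scaleA a b x :
  quotmod_scale a (quotmod_scale b x) = quotmod_scale (a * b) x.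
Proof. by rewrite -[x]reprK -(quotmod_piZ b) -!quotmod_piZ scalerA. Qed.
Fact quotmod_scale1 : left_id 1 quotmod_scale.
Proof. by move=> x; rewrite -[x]reprK -!quotmod_piZ scale1r. Qed.
Fact quotmod_scaleDr :
  right_distributive quotmod_scale +%R.
Proof.
move=> a x y; rewrite -[x]reprK -[y]reprK.
by rewrite -quotmod_piD -!quotmod_piZ scalerDr quotmod_piD.
Qed.
Fact quotmod_scaleDl x : {morph quotmod_scale^~ x : a b / a + b}.
Proof.
by move=> a b; rewrite -[x]reprK -!quotmod_piZ scalerDl quotmod_piD.
Qed.
HB.instance Definition _ := GRing.Zmodule_isLmodule.Build k quotmod
  quotmod_scaleA quotmod_scale1 quotmod_scaleDr quotmod_scaleDl.

End Quotient.

Section Dimension.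
Variables (k : fieldType) (V : lmodType k).
Implicit Types A B : set V.

Definition lspan B : set V :=
  [set v | exists2 r : seq (k * V), {in r, forall p, B p.2} &
     v = \sum_(p <- r) p.1 *: p.2].

Definition lfree B : Prop :=
  forall s : seq V, uniq s -> [set` s] `<=` B ->
  forall c : V -> k, \sum_(x <- s) c x *: x = 0 -> {in s, forall x, c x = 0}.

Definition is_basis A B : Prop := lspan B = A /\ lfree B.

(* The cardinality of the type S is the dimension of A. *)
Definition has_dim A (S : Type) : Prop :=
  exists2 B, is_basis A B & [set: S] #= B.

Definition finite_dim A : Prop := exists s : seq V, lspan [set` s] = A.

End Dimension.

Section FinitePotent.
Variables (k : fieldType) (V : lmodType k) (phi : {linear V -> V}).

Definition finite_potent : Prop :=
  exists2 n, (1 <= n)%N & finite_dim (range (iter n phi)).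

Definition nilpotent_on (U : submodClosed V) (n : nat) : Prop :=
  {in U, forall u, iter n phi u = 0}.

Record AST_decomposition (W U : submodClosed V) : Prop := {
  AST_sum : forall v, v \in addmod W U;
  AST_direct : forall v, v \in W -> v \in U -> v = 0;
  AST_stableW : {homo phi : v / v \in W};
  AST_stableU : {homo phi : v / v \in U};
  AST_finite_dim : finite_dim [set` W];
  AST_auto : set_bij [set` W] [set` W] phi;
  AST_nilp : exists n, nilpotent_on U n }.

Lemma AST_range W U n : AST_decomposition W U -> nilpotent_on U n ->
  (forall v, v \in W <-> range (iter n phi) v) /\ U =i kermod (iter n phi).
Proof.
move=> h nU.
have iW i v : v \in W -> iter i phi v \in W.
  by move=> vW; elim: i => //= i; apply: (AST_stableW h).
have [_ injW surjW] := AST_auto h.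
have inj0 i v : v \in W -> iter i phi v = 0 -> v = 0.
  move=> vW; elim: i => //= i IH e; apply: IH.
  by apply: injW; rewrite ?inE /= ?linear0 ?iW ?rpred0.
split=> v.
  split=> [|[u _ <-]].
    elim: n v {nU} => [|n IH] v vW; first by exists v.
    have [w /= wW <-] := surjW v vW; have [u _ <-] := IH w wW.
    by exists u.
  have /asboolP[a [b [aW bU ->]]] := AST_sum h u.
  by rewrite linearD/= (nU b)// addr0 iW.
rewrite inE; apply/idP/eqP => [/nU//|].
have /asboolP[a [b [aW bU ->]]] := AST_sum h v.
by rewrite linearD/= (nU b)// addr0 => /inj0-> //; rewrite add0r.
Qed.

Lemma AST_unique W U W' U' : AST_decomposition W U -> AST_decomposition W' U' ->
  W =i W' /\ U =i U'.
Proof.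
move=> h h'; have [n nU] := AST_nilp h; have [n' nU'] := AST_nilp h'.
have nN : nilpotent_on U (n' + n) by move=> u uU; rewrite iterD nU ?linear0.
have nN' : nilpotent_on U' (n' + n).
  by move=> u uU; rewrite addnC iterD nU' ?linear0.
have [hW hU] := AST_range h nN; have [hW' hU'] := AST_range h' nN'.
split=> v; last by rewrite hU hU'.
by apply/idP/idP => [/hW/hW'|/hW'/hW].
Qed.

Lemma AST_exists : finite_potent ->
  exists WU : submodClosed V * submodClosed V, AST_decomposition WU.1 WU.2.
Proof.
move=> [n _ [s sE]].
pose gen d := exists j (w : 'I_d -> V), forall v, exists c : 'rV[k]_d,
  iter j phi v = \sum_i c 0 i *: iter j phi (w i).
have gen_ex : exists d, `[< gen d >].
  have mem_s x : x \in s -> exists u, x = iter n phi u.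
    move=> xs; suff [u _ <-] : range (iter n phi) x by exists u.
    rewrite -sE; exists [:: (1, x)]; last by rewrite big_seq1 scale1r.
    by move=> p /=; rewrite inE => /eqP->.
  exists (size s); apply/asboolP; exists n.
  have wP (i : 'I_(size s)) : exists u, s`_i = iter n phi u.
    by apply: mem_s; rewrite mem_nth.
  have [w wE] := choice wP; exists w => v.
  have : range (iter n phi) (iter n phi v) by exists v.
  rewrite -sE => -[t ts ->].
  exists (\row_i \sum_(p <- t | index p.2 s == i) p.1).
  rewrite [LHS](_ : _ = \sum_(p <- t)
      \sum_(i < size s | index p.2 s == i) p.1 *: s`_i).
    rewrite (exchange_big_dep xpredT)//=; apply: eq_bigr => i _.
    by rewrite mxE scaler_suml wE.
  apply: eq_big_seq => p /ts /= xs.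
  have xi : (index p.2 s < size s)%N by rewrite index_mem.
  by rewrite (big_pred1 (Ordinal xi)) ?nth_index// => i; rewrite eq_sym.
case: (ex_minnP gen_ex) => d /asboolP[j [w wP]] dmin.
have dmin' d' : (d' < d)%N -> ~ gen d'.
  by move=> lt_d /asboolP/dmin; rewrite leqNgt lt_d.
pose E (c : 'rV[k]_d) := \sum_i c 0 i *: iter j phi (w i).
have EE c : E c = iter j phi (\sum_i c 0 i *: w i).
  by rewrite linear_sum; apply: eq_bigr => i _; rewrite linearZ.
have phiE c : phi (E c) = \sum_i c 0 i *: iter j.+1 phi (w i).
  by rewrite linear_sum; apply: eq_bigr => i _; rewrite linearZ.
have free c : phi (E c) = 0 -> c = 0.
  move=> c0; apply/eqP; apply: contraT => /matrix0Pn[i0 [i1 ci]].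
  move: ci; rewrite (ord1 i0) => ci {i0}.
  have [d' dE] : exists d', d = d'.+1 by case: (d) i1 {ci} => [[]|d'] //; exists d'.
  subst d; exfalso; apply: (dmin' d') => //.
  exists j.+1, (fun i => w (lift i1 i)) => v.
  have [b bE] := wP v; rewrite -/(E b) in bE.
  pose c' := b - (b 0 i1 / c 0 i1) *: c.
  have Ec' : phi (E c') = iter j.+1 phi v.
    rewrite iterS bE !phiE.
    rewrite [LHS](_ : _ = \sum_i b 0 i *: iter j.+1 phi (w i) - (b 0 i1 / c 0 i1) *: phi (E c)).
      by rewrite c0 scaler0 subr0.
    rewrite phiE scaler_sumr -sumrB; apply: eq_bigr => i _.
    by rewrite scalerA -scalerBl !mxE.
  exists (\row_i c' 0 (lift i1 i)); rewrite -Ec' phiE.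
  rewrite (bigD1_ord i1)//= !mxE divfK// subrr scale0r add0r.
  by apply: eq_bigr => i _; rewrite !mxE.
have surj c : exists c', phi (E c') = E c.
  have AP i : exists a : 'rV[k]_d, iter j.+1 phi (w i) = E a.
    by have [a aE] := wP (phi (w i)); exists a; rewrite iterSr aE.
  have [a aE] := choice AP; pose A := \matrix_i a i.
  have phiA b : phi (E b) = E (b *m A).
    rewrite phiE; under eq_bigr do rewrite aE scaler_sumr.
    rewrite exchange_big; apply: eq_bigr => l _.
    by rewrite mxE scaler_suml; apply: eq_bigr => i _; rewrite scalerA mxE.
  have Au : A \in unitmx.
    rewrite -row_free_unit; apply/row_freeP.
    have /inj_row_free : forall b : 'rV_d, b *m A = 0 -> b = 0.
      move=> b bA; apply: free; rewrite phiA bA.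
      by rewrite /E big1// => i _; rewrite mxE scale0r.
    by move/row_freeP.
  by exists (c *m invmx A); rewrite phiA mulmxKV.
pose T : submodClosed V := kermod (\0 : {linear V -> V}).
have inT v : v \in T by rewrite inE.
pose W : submodClosed V := immod (iter j phi) T.
have WP v : reflect (exists c, v = E c) (v \in W).
  apply: (iffP idP) => [|[c ->]]; rewrite inE.
  by move=> -[u _ <-]; exact: wP.
  by rewrite EE; eexists; last reflexivity; exact: inT.
have phi0 v : v \in W -> phi v = 0 -> v = 0.
  move=> /WP[c ->] /free->; rewrite /E big1// => i _; by rewrite mxE scale0r.
have phiW v : v \in W -> phi v \in W.
  by move=> /WP[c ->]; rewrite EE -iterS iterSr; apply/WP; exact: wP.
have surjW v : v \in W -> exists2 u, u \in W & phi u = v.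
  by move=> /WP[c ->]; have [c' <-] := surj c; exists (E c') => //; apply/WP; exists c'.
exists (W, kermod (iter j phi) : submodClosed V) => /=; split.
- move=> v; rewrite inE.
  have [u uW uE] : exists2 u, u \in W & iter j phi u = iter j phi v.
    have : iter j phi v \in W by apply/WP; exact: wP.
    move: (iter j phi v) => x xW; elim: (j) => [|i [u uW <-]]; first by exists x.
    by have [u' u'W <-] := surjW u uW; exists u' => //; rewrite iterSr.
  exists u, (v - u); rewrite uW inE linearB/= uE subrr eqxx.
  by rewrite addrC subrK.
- move=> v vW; rewrite inE => /eqP; elim: (j) => //= i IH e; apply: IH.
  by apply: phi0 => //; elim: (i) => //= i' ?; apply: phiW.
- exact: phiW.
- move=> v; rewrite !inE => /eqP v0; apply/eqP.
  transitivity (phi (iter j phi v)); first by rewrite -iterS iterSr.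
  by move: v0 => /= ->; exact: linear0.
- exists [seq iter j phi (w i) | i <- enum 'I_d]; apply/seteqP; split=> v /=.
    move=> [r rs ->]; rewrite big_seq rpred_sum// => p /rs /=.
    by move=> /mapP[i _ ->]; apply: rpredZ; apply/WP; exact: wP.
  move=> /WP[c ->].
  exists [seq (c 0 i, iter j phi (w i)) | i <- enum 'I_d].
    by move=> p /mapP[i _ ->]; apply/mapP; exists i; rewrite ?mem_enum.
  by rewrite big_map /= big_enum.
- split=> [v /=|u v|v /= vW]; first exact: phiW.
    rewrite !inE /= => uW vW e; apply/eqP; rewrite -subr_eq0; apply/eqP.
    by apply: phi0; rewrite ?rpredB// linearB e subrr.
  by have [u uW <-] := surjW v vW; exists u.
- by exists j => u; rewrite inE => /eqP.
Qed.

Section Index.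
Variable fp : finite_potent.

Let WU := sval (cid (AST_exists fp)).
Definition AST_W : submodClosed V := WU.1.
Definition AST_U : submodClosed V := WU.2.

Lemma ASTP : AST_decomposition AST_W AST_U.
Proof. exact: svalP (cid (AST_exists fp)). Qed.

Fact ex_nilpotency : exists n, `[< nilpotent_on AST_U n >].
Proof. by have [n nU] := AST_nilp ASTP; exists n; apply/asboolP. Qed.

Definition fp_index : nat := ex_minn ex_nilpotency.

(* The subspace ker g^i, where g is the restriction of phi to AST_U. *)
Definition kerU (i : nat) : submodClosed V :=
  capmod AST_U (kermod (iter i phi)).

Definition mu_den (i : nat) : submodClosed V :=
  addmod (kerU i.-1) (immod phi (kerU i.+1)).

(* The space ker g^i / [ker g^(i-1) + g (ker g^(i+1))], as a subspace
   of V / mu_den i. *)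
Definition mu_space (i : nat) : set (quotmod (mu_den i)) :=
  \pi_(quotmod (mu_den i)) @` [set` kerU i].

Definition X_1 : set {linear V -> V} :=
  [set psi : {linear V -> V} | phi \o psi \o phi =1 phi].

Definition X_GD : set {linear V -> V} :=
  [set psi : {linear V -> V} | phi \o psi \o phi =1 phi /\
     psi \o iter fp_index phi =1 iter fp_index phi \o psi].

Definition X_GD1 : set {linear V -> V} :=
  [set psi : {linear V -> V} | psi \o phi \o psi =1 psi /\
     exists phi1 phiGD : {linear V -> V}, [/\ X_1 phi1, X_GD phiGD,
       psi \o phi =1 phiGD \o phi & phi \o psi =1 phi \o phi1]].

End Index.

End FinitePotent.

Arguments mu_space {k V phi} fp i.

(* Main.v *)
Require Import Defs.
From HB Require Import structures.
From mathcomp Require Import all_boot all_algebra.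
From mathcomp Require Import boolp classical_sets functions cardinality.
From mathcomp Require Import zify.
Import GRing.Theory.
Local Open Scope ring_scope.
Local Open Scope classical_set_scope.

(* Membership in X_phi(GD1) amounts to phi psi phi = phi, psi phi psi = psi and
   psi = phi^-1 on W. Lifting bases of the spaces defining mu_i gives heads
   e_(i,s) of Jordan chains: the phi^j e_(i,s) with j < i form a basis of U.
   Such a psi satisfies psi (phi^(j+1) e_(i,s)) = phi^j e_(i,s) + a_(i,s,j) with
   a_(i,s,j) in ker phi (0 <= j < i - 1); the a_(i,s,j) are arbitrary and
   determine psi on im phi. Since psi = psi phi psi, the value psi e_(i,s) is
   then determined by its class modulo ker phi, which is again arbitrary. *)

(** * Constructing linear maps; finite linear combinations *)

Section LinearCombinations.
Set Implicit Arguments.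
Unset Strict Implicit.
Variables (k : fieldType) (V V' : lmodType k).

Lemma linear_ext (f g : {linear V -> V'}) : f =1 g -> f = g.
Proof.
move=> /funext; case: f g => [f [[f1] [f2]]] [g [[g1] [g2]]]/= e.
subst g; congr GRing.Linear.Pack.
by rewrite (Prop_irrelevance f1 g1) (Prop_irrelevance f2 g2).
Qed.

(** The last two hypotheses make [R] functional: the difference of two values at [v] is a value at
    0. Maps can thus be defined through decompositions that are not unique as written. *)
Lemma linear_of_rel (R : V -> V' -> Prop) :
  (forall v, exists v', R v v') ->
  (forall a u v u' v', R u u' -> R v v' -> R (a *: u + v) (a *: u' + v')) ->
  (forall v', R 0 v' -> v' = 0) ->
  exists h : {linear V -> V'}, forall v v', R v v' <-> h v = v'.
Proof.
move=> Rtot RP R0; have [h hP] := choice Rtot.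
have hE v v' : R v v' -> h v = v'.
  move=> Rv; apply/eqP; rewrite -subr_eq0 addrC; apply/eqP/R0.
  by have := RP (-1) _ _ _ _ Rv (hP v); rewrite !scaleN1r addNr.
have hlin : linear h by move=> a u v; apply: hE; apply: RP.
pose mh := GRing.isLinear.Build k V V' *:%R h hlin.
exists (HB.pack_for {linear V -> V'} h mh) => v v'.
by split=> [/hE|<-]; last exact: hP.
Qed.

(** Indices may repeat in the list, so that adding combinations is plain concatenation. *)
Definition lcomb (I : Type) (W : lmodType k) (b : I -> W) (r : seq (k * I)) : W :=
  \sum_(q <- r) q.1 *: b q.2.

Definition lfree_on (I : eqType) (P : I -> Prop) (b : I -> V) : Prop :=
  forall (r : seq I) (c : I -> k), uniq r -> (forall i, i \in r -> P i) ->
  \sum_(i <- r) c i *: b i = 0 -> forall i, i \in r -> c i = 0.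

Lemma lcombE (I : eqType) (W : lmodType k) (b : I -> W) r :
  lcomb b r =
  \sum_(i <- undup (map snd r)) (\sum_(q <- r | q.2 == i) q.1) *: b i.
Proof.
under eq_bigr do rewrite scaler_suml.
rewrite (exchange_big_dep xpredT)//= /lcomb; apply: eq_big_seq => q qr.
rewrite big_mkcond (bigD1_seq q.2)/= ?undup_uniq// ?mem_undup ?map_f//.
by rewrite eqxx big1 ?addr0// => i /negbTE; rewrite eq_sym => ->.
Qed.

(** Once repeated indices are grouped, every total coefficient vanishes by freeness. This makes the
    linear extension of values [f] prescribed on a free family well defined. *)
Lemma lcomb_eq0 (I : eqType) (P : I -> Prop) (b : I -> V) (f : I -> V') r :
  lfree_on P b -> (forall q, q \in r -> P q.2) -> lcomb b r = 0 ->
  lcomb f r = 0.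
Proof.
move=> bfree rP; rewrite !lcombE => b0.
rewrite big1_seq// => i /= ir; rewrite (bfree _ _ _ _ b0 _ ir) ?undup_uniq//.
  by rewrite scale0r.
by move=> j; rewrite mem_undup => /mapP[q /rP ? ->].
Qed.

Lemma lcomb_lin (I : Type) (W : lmodType k) (b : I -> W) a r s :
  lcomb b ([seq (a * q.1, q.2) | q <- r] ++ s) = a *: lcomb b r + lcomb b s.
Proof.
rewrite /lcomb big_cat big_map scaler_sumr; congr (_ + _).
by apply: eq_bigr => q _; rewrite scalerA.
Qed.

Lemma lcomb_in (I : eqType) (P : I -> Prop) a (r s : seq (k * I)) :
  (forall q, q \in r -> P q.2) -> (forall q, q \in s -> P q.2) ->
  forall q, q \in [seq (a * q.1, q.2) | q <- r] ++ s -> P q.2.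
Proof.
by move=> rP sP q; rewrite mem_cat => /orP[/mapP[p /rP ? ->]//|/sP].
Qed.

End LinearCombinations.

(** * GD1 inverses in terms of the AST decomposition *)

Section GD1Inverses.
Set Implicit Arguments.
Unset Strict Implicit.
Variables (k : fieldType) (V : lmodType k) (phi : {linear V -> V}).
Variable fp : finite_potent phi.
Local Notation U := (AST_U fp).
Local Notation W := (AST_W fp).
Local Notation m := (fp_index fp).

Lemma fp_index_nilp : nilpotent_on phi U m.
Proof. by rewrite /fp_index; case: ex_minnP => n /asboolP. Qed.

Lemma in_kerU i v : (v \in kerU fp i) = (v \in U) && (iter i phi v == 0).
Proof. by rewrite !inE. Qed.

Lemma AST_WU v : exists2 u, u \in U & v - u \in W.
Proof.
have /asboolP[w [u [wW uU ->]]] := AST_sum (ASTP fp) v.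
by exists u; rewrite ?addrK.
Qed.

Lemma AST_inj w w' : w \in W -> w' \in W -> phi w = phi w' -> w = w'.
Proof.
by move=> wW w'W; have [_ + _] := AST_auto (ASTP fp); apply; rewrite inE.
Qed.

Lemma AST_surj w : w \in W -> exists2 w', w' \in W & phi w' = w.
Proof. by move=> wW; have [_ _ /(_ w wW)[w']] := AST_auto (ASTP fp); exists w'. Qed.

Lemma AST_projU :
  exists p : {linear V -> V}, forall v u, (u \in U /\ v - u \in W) <-> p v = u.
Proof.
apply: (linear_of_rel (R := fun v u => u \in U /\ v - u \in W)).
- by move=> v; have [u ? ?] := AST_WU v; exists u.
- move=> a u v u' v' [u'U uW] [v'U vW]; split; first by rewrite rpredD ?rpredZ.
  by rewrite opprD addrACA -scalerBr rpredD ?rpredZ.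
- move=> u [uU]; rewrite sub0r => uW.
  by apply: (AST_direct (ASTP fp)) => //; rewrite -[u]opprK -scaleN1r rpredZ.
Qed.

(** Left to right, [phi psi phi = phi phi1 phi = phi], and the G-Drazin inverse forces the values on
    [W]. Right to left, [psi] itself serves as the {1}-inverse and only a G-Drazin inverse has to be
    built. *)
Lemma X_GD1P (psi : {linear V -> V}) : X_GD1 fp psi <->
  [/\ phi \o psi \o phi =1 phi, psi \o phi \o psi =1 psi &
      {in W, forall w, psi (phi w) = w}].
Proof.
have [Wim Uker] := AST_range (ASTP fp) fp_index_nilp.
have stW := AST_stableW (ASTP fp); have stU := AST_stableU (ASTP fp).
split=> [[psi2 [phi1 [chi [phi1P [chi1 chiC] psiphi phipsi]]]]|[psi1 psi2 psiW]].
  have psi1 : phi \o psi \o phi =1 phi.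
    by move=> v /=; rewrite -[RHS]phi1P; exact: phipsi.
  split=> // w wW; apply: AST_inj => //; last exact: psi1.
  (* The range of [phi^m] is [W], and [chi] commutes with [phi^m], so [chi] maps [W] into itself;
     injectivity of [phi] on [W] then applies. *)
  rewrite (psiphi w : psi (phi w) = _) /=.
  have /Wim[u _ <-] := stW _ wW.
  by apply/Wim; exists (chi u) => //; rewrite -[LHS]chiC.
have [p pP] := AST_projU.
have pU v : p v \in U by have [] := (pP v _).2 erefl.
have pW v : v - p v \in W by have [] := (pP v _).2 erefl.
have p0 w : w \in W -> p w = 0 by move=> wW; apply/pP; rewrite rpred0 subr0.
have pid u : u \in U -> p u = u by move=> uU; apply/pP; rewrite subrr rpred0.
have pphi v : p (phi v) = phi (p v).
  by apply/pP; rewrite -linearB; split; [apply: stU|apply: stW].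
have psiU u : u \in U -> psi (phi u) \in U.
  rewrite !Uker !inE; case: (m) => [/eqP/= ->|n]; first by rewrite !linear0.
  by move=> /eqP/=; rewrite -!iterS !iterSr => u0; rewrite (psi1 u : phi (psi (phi u)) = _) u0.
(* A G-Drazin inverse has to preserve [U], which [psi] only does on [phi U]:
   on [U], [psi] is followed by the projection onto [U] along [W]. *)
pose chi : {linear V -> V} :=
  (psi \o (idfun \- p)) \+ (p \o psi \o p).
have chiphi v : chi (phi v) = psi (phi v).
  rewrite /chi/= pphi (pid _ (psiU _ (pU v))).
  by rewrite -linearD subrK.
split=> //; exists psi, chi; split=> //; first split=> //.
- by move=> v; rewrite -[RHS]psi1 -[LHS]/(phi (chi (phi v))) chiphi.
(* Both sides depend only on the [W]-component [a] of [v], since [phi^m] kills [U]; on [W], [psi]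
   inverts [phi] and so commutes with [phi^m]. *)
- move=> v /=; set a := v - p v; have aW : a \in W := pW v.
  have -> : iter m phi v = iter m phi a by rewrite /a linearB/= (fp_index_nilp (pU v)) subr0.
  rewrite [RHS]linearD/= (fp_index_nilp (pU _)) addr0.
  have [b bW <-] := AST_surj aW; rewrite psiW// -iterSr iterS.
  have mW : iter m phi b \in W by apply/Wim; exists b.
  by rewrite (p0 (phi _)) ?stW// !linear0 !addr0 psiW.
- by move=> v; rewrite -[RHS]/(chi (phi v)) chiphi.
Qed.

End GD1Inverses.

(** * A Jordan basis of [U], and linear maps prescribed on it *)

Section JordanBasis.
Local Open Scope quotient_scope.
Set Implicit Arguments.
Unset Strict Implicit.
Variables (k : fieldType) (V : lmodType k) (phi : {linear V -> V}).
Variable fp : finite_potent phi.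
Local Notation U := (AST_U fp).
Local Notation W := (AST_W fp).
Local Notation m := (fp_index fp).

Lemma mu_denP i v : reflect
  (exists a b, [/\ a \in kerU fp i.-1, b \in kerU fp i.+1 & v = a + phi b])
  (v \in mu_den fp i).
Proof.
rewrite inE; apply: (iffP (asboolP _)) => [[a [b [aK + ->]]]|[a [b [aK bK ->]]]].
  by rewrite inE => -[c cK <-]; exists a, c.
by exists a, (phi b); split=> //; rewrite inE; exists b.
Qed.

Lemma iter_kerU i n v : v \in kerU fp i -> (i <= n)%N -> iter n phi v = 0.
Proof.
rewrite in_kerU => /andP[_ /eqP v0] /subnK <-.
by rewrite iterD v0 linear0.
Qed.

Lemma kerU_sub i v : v \in kerU fp i -> v \in U.
Proof. by rewrite in_kerU => /andP[]. Qed.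

Lemma iter_U n v : v \in U -> iter n phi v \in U.
Proof. by move=> vU; elim: n => //= n; apply: (AST_stableU (ASTP fp)). Qed.

Lemma iter_in_kerU i t v : v \in U -> iter (i + t) phi v = 0 ->
  iter t phi v \in kerU fp i.
Proof. by move=> vU v0; rewrite in_kerU iter_U// -iterD v0 eqxx. Qed.

(** States inside [V], modulo [mu_den], that [E] lifts a basis of [mu_space fp i]. *)
Record chain_heads (i : nat) (E : set V) : Prop := {
  heads_ker : forall x, E x -> x \in kerU fp i;
  heads_gen : forall v, v \in kerU fp i ->
    exists2 r : seq (k * V), (forall q, q \in r -> E q.2) &
      v - lcomb id r \in mu_den fp i;
  heads_free : forall (r : seq V) (c : V -> k),
    uniq r -> (forall x, x \in r -> E x) ->
    \sum_(x <- r) c x *: x \in mu_den fp i -> forall x, x \in r -> c x = 0 }.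

Lemma pi_lcomb (A : submodClosed V) (I : Type) (r : seq I) (c : I -> k) (F : I -> V) :
  \pi_(quotmod A) (\sum_(x <- r) c x *: F x) =
  \sum_(x <- r) c x *: \pi_(quotmod A) (F x).
Proof.
elim: r => [|x r IH].
  by rewrite !big_nil -[in LHS](scale0r 0) quotmod_piZ; exact: scale0r.
by rewrite !big_cons quotmod_piD quotmod_piZ IH.
Qed.

Lemma has_dim_heads (i : nat) (S : Type) : has_dim (mu_space fp i) S ->
  exists2 e : S -> V, injective e & chain_heads i (range e).
Proof.
move=> [B [Bspan Bfree] /card_bijP[f f_bij]].
pose b s := set_val (f (to_setT s)).
have b_inj : injective b.
  move=> s t /val_inj/(bij_inj f_bij) /(congr1 val); exact.
have b_surj y : B y -> exists s, b s = y.
  move=> By; have [g _ gK] := f_bij.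
  exists (val (g (SigSub (mem_set By)))); rewrite /b.
  have -> : to_setT (val (g (SigSub (mem_set By)))) = g (SigSub (mem_set By)).
    exact: val_inj.
  by rewrite gK.
have Bb s : B (b s) by exact: set_valP.
(* Representatives are taken in [kerU]; the value 0 outside [mu_space] only makes the lifting
   total. *)
have lP y : exists v, mu_space fp i y -> v \in kerU fp i /\ \pi_(quotmod _) v = y.
  by have [[v vK <-]|ny] := pselect (mu_space fp i y); [exists v|exists 0].
have [l {}lP] := choice lP.
have BM y : B y -> mu_space fp i y.
  rewrite -Bspan => By; exists [:: (1, y)]; last by rewrite big_seq1 scale1r.
  by move=> p; rewrite inE => /eqP->.
have lK y : B y -> \pi_(quotmod (mu_den fp i)) (l y) = y by move=> /BM/lP[].
exists (l \o b) => [s t /= st|].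
  by apply: b_inj; rewrite -[LHS]lK// -[RHS]lK// st.
split=> [x [s _ <-]|v vK|r c r_uniq rE sum_mu x xr].
- by have [] := lP _ (BM _ (Bb s)).
- have : mu_space fp i (\pi_(quotmod _) v) by exists v.
  rewrite -Bspan => -[r rB vE]; exists [seq (q.1, l q.2) | q <- r].
    by move=> p /mapP[q /rB/b_surj[s sE] ->]; exists s; rewrite //= sE.
  apply/quotmod_eq; rewrite vE /lcomb pi_lcomb big_map.
  by apply: eq_big_seq => q /rB By /=; rewrite lK.
- have eK y : y \in r -> l (\pi_(quotmod (mu_den fp i)) y) = y.
    by move=> /rE[s _ <-] /=; rewrite lK.
  rewrite -(eK x xr); apply: (Bfree (map \pi_(quotmod (mu_den fp i)) r) _ _ (c \o l)).
  + by rewrite map_inj_in_uniq// => y z yr zr yz; rewrite -(eK y yr) yz eK.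
  + by move=> y /= /mapP[z /rE[s _ <-] ->] /=; rewrite lK.
  + rewrite big_map; transitivity (\pi_(quotmod (mu_den fp i)) (\sum_(y <- r) c y *: y)).
      by rewrite pi_lcomb; apply: eq_big_seq => y yr /=; rewrite eK.
    transitivity (\pi_(quotmod (mu_den fp i)) (0 : V)).
      by apply/quotmod_eq; rewrite subr0.
    by rewrite -(scale0r 0) quotmod_piZ; exact: scale0r.
  + by rewrite map_f.
Qed.

Variable E : nat -> set V.
Hypothesis EP : forall i, (1 <= i <= m)%N -> chain_heads i (E i).

(* The triple (i, j, x) stands for the vector [phi^j x] of the Jordan chain of
   length i with head x. *)
Definition jordan_pos (p : nat * nat * V) : Prop :=
  [/\ (p.1.1 <= m)%N, (p.1.2 < p.1.1)%N & E p.1.1 p.2].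
Definition jordan_vec (p : nat * nat * V) : V := iter p.1.2 phi p.2.

Lemma jordan_head_ker p : jordan_pos p -> p.2 \in kerU fp p.1.1.
Proof.
case=> im ji; apply: (heads_ker (EP _)).
by rewrite im andbT (leq_ltn_trans _ ji).
Qed.

Let D (v : V) : Prop := exists2 r : seq (k * (nat * nat * V)),
  (forall q, q \in r -> jordan_pos q.2) & v = lcomb jordan_vec r.

Let D0 : D 0. Proof. by exists [::] => //; rewrite /lcomb big_nil. Qed.

Let D_lin a u v : D u -> D v -> D (a *: u + v).
Proof.
move=> [r rP ->] [s sP ->].
exists ([seq (a * q.1, q.2) | q <- r] ++ s); last by rewrite lcomb_lin.
exact: lcomb_in.
Qed.

Let D_add u v : D u -> D v -> D (u + v).
Proof. by move=> uD vD; rewrite -[u]scale1r; exact: D_lin. Qed.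

Let D_vec p : jordan_pos p -> D (jordan_vec p).
Proof.
move=> pP; exists [:: (1, p)]; first by move=> q; rewrite inE => /eqP->.
by rewrite /lcomb big_seq1 scale1r.
Qed.

Let D_lcomb (I : eqType) (b : I -> V) (r : seq (k * I)) :
  (forall q, q \in r -> D (b q.2)) -> D (lcomb b r).
Proof.
elim: r => [|q r IH] rD; first by rewrite /lcomb big_nil.
rewrite /lcomb big_cons; apply: D_lin; first by apply: rD; rewrite mem_head.
by apply: IH => p pr; apply: rD; rewrite inE pr orbT.
Qed.

(** [phi] moves one step along a chain, and the last vector goes to 0 because the head lies in ker
    g^i. *)
Let D_phi v : D v -> D (phi v).
Proof.
move=> [r rP ->]; rewrite /lcomb linear_sum; under eq_bigr do rewrite linearZ/=.
apply: (D_lcomb (b := fun p => phi (jordan_vec p))) => -[a [[i j] x]] /rP/= pP.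
have xK := jordan_head_ker pP; have [/= im ji Ex] := pP.
rewrite /jordan_vec/= -iterS.
have [ji1|ij1] := ltnP j.+1 i; first by apply: (D_vec (p := (i, j.+1, x))).
by rewrite (iter_kerU xK).
Qed.

Let D_iter n v : D v -> D (iter n phi v).
Proof. by move=> vD; elim: n => //= n; exact: D_phi. Qed.

(** Modulo ker g^(i-1), phi^t b is in the span. Write b as a combination of heads of length i + t
    plus a + phi c: phi^t a falls into ker g^(i-1), and phi^(t+1) c is the same problem for t + 1.
    The recursion, bounded by [d], stops once i + t exceeds m, where phi^t b itself lies in ker
    g^(i-1). *)
Let D_chain i d t b : (1 <= i)%N -> (m < i + t + d)%N -> b \in kerU fp (i + t) ->
  exists2 a, a \in kerU fp i.-1 & D (iter t phi b - a).
Proof.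
move=> i0; elim: d t b => [|d IH] t b; last first.
  have [mit _ bK|itm mitd bK] := ltnP m (i + t); first by apply: IH => //; rewrite ltn_addr.
  have it : (1 <= i + t <= m)%N by rewrite itm andbT addn_gt0 i0.
  have [r rE /mu_denP[a [c [aK cK bE]]]] := heads_gen (EP it) bK.
  have [||a' a'K Da'] := IH t.+1 c; first by rewrite addnS addSn -addnS.
    by rewrite addnS.
  exists (iter t phi a + a').
    rewrite rpredD//; apply: iter_in_kerU; first exact: kerU_sub aK.
    by apply: (iter_kerU aK); rewrite -(prednK i0).
  have -> : b = lcomb id r + (a + phi c) by rewrite -bE addrC subrK.
  have -> : iter t phi (lcomb id r + (a + phi c)) - (iter t phi a + a') =
      iter t phi (lcomb id r) + (iter t.+1 phi c - a').
    by rewrite !linearD/= -iterS iterSr -addrA [in X in _ + X]addrACA subrr add0r.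
  apply: D_add => //; apply: D_iter; apply: D_lcomb => -[e x] /rE/= Ex.
  apply: (D_vec (p := (i + t, 0, x)%N)); split=> //=; first by case/andP: it.
rewrite addn0 => mit bK; exists (iter t phi b); last by rewrite subrr.
apply: iter_in_kerU; first exact: kerU_sub bK.
have mt : (m <= i.-1 + t)%N by lia.
by rewrite -(subnK mt) iterD (fp_index_nilp (kerU_sub bK)) linear0.
Qed.

(** Induction on [i]: [D_chain] with t = 0 leaves a remainder in the preceding kernel. *)
Let D_kerU i v : (i <= m)%N -> v \in kerU fp i -> D v.
Proof.
elim: i v => [|i IH] v im vK; first by rewrite (iter_kerU vK (leqnn 0) : v = 0).
have [||a aK Dva] := @D_chain i.+1 m 0 v isT; rewrite ?addn0 ?addSn ?ltnS ?leq_addl//.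
by rewrite -[v](subrK a); apply: D_add => //; apply: IH => //; exact: ltnW.
Qed.

Lemma jordan_span v : v \in U -> exists2 r : seq (k * (nat * nat * V)),
  (forall q, q \in r -> jordan_pos q.2) & v = lcomb jordan_vec r.
Proof.
by move=> vU; apply: (D_kerU (leqnn m)); rewrite in_kerU vU fp_index_nilp//=.
Qed.

Lemma jordan_free : lfree_on jordan_pos jordan_vec.
Proof.
move=> r c r_uniq rP sum0.
(* Descending induction on the height [i - j] and, for a given height, ascending
   induction on the length i of the chain. *)
suff H n : forall i, forall p, p \in r ->
    p.1.1 = i -> (m < n + (p.1.1 - p.1.2))%N -> c p = 0.
  move=> p pr; have [pm jp _] := rP p pr.
  by apply: (H m p.1.1) => //; rewrite -[ltnLHS]addn0 ltn_add2l subn_gt0.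
elim: n => [|n IHn] i.
  move=> p /rP[pm _ _] _; rewrite add0n ltnNge => /negP[].
  by rewrite (leq_trans _ pm)// leq_subr.
elim/ltn_ind: i => i IHi [[i' j] x0] pr /= i'E mh; subst i'.
have [/= im ji Ex0] := rP _ pr.
have i0 : (0 < i)%N by exact: leq_ltn_trans ji.
(* [X] gathers the heads at position (i, j). [Y] gathers the vectors of the same height in longer
   chains, pulled back so that phi^i Y is their image under phi^(i-j-1). *)
pose X := \sum_(p <- r | p.1 == (i, j)) c p *: p.2.
pose Y := \sum_(p <- r | (i < p.1.1)%N && (p.1.1 - p.1.2 == i - j)%N)
   c p *: iter (p.1.1 - i.+1) phi p.2.
have XY0 : iter i.-1 phi (X + phi Y) = 0.
  rewrite linearD/= -(iterSr i.-1 phi Y) prednK//.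
  (* Applying phi^(i-j-1) kills all smaller heights and sends a vector of height i - j with head x
     in a chain of length i' to phi^(i'-1) x. Greater heights, and shorter chains of this height,
     have zero coefficients by induction. *)
  have := congr1 (iter (i - j).-1 phi) sum0; rewrite linear0 => <-.
  rewrite /X /Y !linear_sum/= (big_mkcond (fun p => _ == _)) (big_mkcond (fun p => _ && _)).
  rewrite -big_split/=; apply: eq_big_seq => -[[i' j'] x] qr /=.
  have qP := rP _ qr; have [/= im' ji' Ex'] := qP.
  have xK : x \in kerU fp i' := jordan_head_ker qP.
  rewrite !linearZ/= /jordan_vec/= -!iterD xpair_eqE.
  have [hlt|hgt|heq] := ltngtP (i' - j')%N (i - j)%N.
  - rewrite andbF addr0 (iter_kerU xK (n := ((i - j).-1 + j')%N)); last by lia.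
    case: eqP => [i'E|_] /=; last by rewrite scaler0.
    case: eqP => [j'E|_]; last by rewrite scaler0.
    by lia.
  - have -> : c (i', j', x) = 0 by apply: (IHn i' _ qr) => //=; lia.
    by rewrite !scale0r ?if_same addr0.
  have [i'i|ii'|i'E] := ltngtP i' i.
  - have -> : c (i', j', x) = 0 by apply: (IHi i' i'i _ qr) => //=; lia.
    by rewrite !scale0r ?if_same addr0.
  - rewrite add0r; congr (_ *: iter _ _ _); lia.
  - have -> : j' == j by lia.
    rewrite addr0; congr (_ *: iter _ _ _); lia.
have XU : X \in U.
  rewrite /X big_seq_cond rpred_sum// => p /andP[/rP/jordan_head_ker/kerU_sub pU _].
  exact: rpredZ.
have YK : Y \in kerU fp i.+1.
  rewrite /Y big_seq_cond rpred_sum// => p /andP[/rP/jordan_head_ker pK /andP[ip _]].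
  apply: rpredZ; apply: iter_in_kerU; first exact: kerU_sub pK.
  by rewrite subnKC// (iter_kerU pK).
(* X = (X + phi Y) + phi (- Y) has its first term in ker g^(i-1) and - Y in ker g^(i+1); freeness of
   the heads modulo [mu_den] then gives the claim. *)
have Xmu : X \in mu_den fp i.
  apply/mu_denP; exists (X + phi Y), (- Y).
  rewrite linearN addrK -scaleN1r rpredZ// in_kerU XY0 eqxx andbT.
  by rewrite rpredD// (AST_stableU (ASTP fp))// (kerU_sub YK).
pose rij := [seq p.2 | p <- r & p.1 == (i, j)].
apply: (heads_free (EP (i := i) _) (r := rij) (c := fun x => c (i, j, x)) _ _ _ (x := x0)).
- by rewrite i0.
- rewrite map_inj_in_uniq ?filter_uniq// => -[p1 p2] [q1 q2].
  by rewrite !mem_filter/= => /andP[/eqP-> _] /andP[/eqP-> _] ->.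
- by move=> x /mapP[[p1 p2]]; rewrite mem_filter/= => /andP[/eqP-> /rP[_ _ ?]] ->.
- rewrite big_map big_filter (eq_bigr (fun p => c p *: p.2))//.
  by move=> [p1 p2]/= /eqP->.
- by apply/mapP; exists (i, j, x0); rewrite ?mem_filter ?eqxx.
Qed.


(** V is the direct sum of phi(W) = W and U, [phi] is injective on [W], and the Jordan vectors form
    a basis of [U]; so these values determine a linear map. The condition on [W] is the one in
    [X_GD1P]. *)
Lemma jordan_extend (f : nat * nat * V -> V) : exists h : {linear V -> V},
  {in W, forall w, h (phi w) = w} /\
  forall p, jordan_pos p -> h (jordan_vec p) = f p.
Proof.
have LU r : (forall q, q \in r -> jordan_pos q.2) -> lcomb jordan_vec r \in U.
  move=> rP; rewrite /lcomb big_seq rpred_sum// => q /rP/jordan_head_ker/kerU_sub.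
  by move=> qU; rewrite rpredZ ?iter_U.
pose R v v' := exists w r, [/\ w \in W, forall q, q \in r -> jordan_pos q.2,
  v = phi w + lcomb jordan_vec r & v' = w + lcomb f r].
have [|||h hP] := linear_of_rel (R := R).
- move=> v; have [u /jordan_span[r rP ->] /AST_surj[w wW wE]] := AST_WU fp v.
  by exists (w + lcomb f r), w, r; rewrite wE subrK.
- move=> a _ _ _ _ [w [r [wW rP -> ->]]] [w' [s [w'W sP -> ->]]].
  exists (a *: w + w'), ([seq (a * q.1, q.2) | q <- r] ++ s).
  split; [by rewrite rpredD ?rpredZ|exact: lcomb_in| |].
    by rewrite lcomb_lin linearP scalerDr addrACA.
  by rewrite lcomb_lin scalerDr addrACA.
- move=> v' [w [r [wW rP + ->]]] => /esym/eqP; rewrite addr_eq0 => /eqP wE.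
  have phiw0 : phi w = 0.
    apply: (AST_direct (ASTP fp)); first exact: (AST_stableW (ASTP fp)).
    by rewrite wE -scaleN1r rpredZ ?LU.
  have -> : w = 0 by apply: (AST_inj wW); rewrite ?rpred0 ?linear0.
  rewrite add0r; apply: (lcomb_eq0 _ jordan_free rP).
  by apply/eqP; rewrite -oppr_eq0 -wE phiw0.
exists h; split=> [w wW|p pP]; apply/hP.
  by exists w, [::]; rewrite /lcomb !big_nil !addr0.
exists 0, [:: (1, p)]; rewrite /lcomb !big_seq1 !scale1r linear0 !add0r rpred0.
by split=> // q; rewrite inE => /eqP->.
Qed.

Lemma jordan_linear_ext (f g : {linear V -> V}) : {in W, f =1 g} ->
  (forall p, jordan_pos p -> f (jordan_vec p) = g (jordan_vec p)) -> f =1 g.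
Proof.
move=> fgW fgJ v; have [u /jordan_span[r rP ->] wW] := AST_WU fp v.
rewrite -[v](subrK (lcomb jordan_vec r)) [LHS]linearD [RHS]linearD/= fgW//; congr (_ + _).
rewrite /lcomb !linear_sum; apply: eq_big_seq => q /rP qP.
by rewrite !linearZ/= fgJ.
Qed.

End JordanBasis.

(** * Coordinates of a GD1 inverse along the Jordan chains *)

Theorem theorem3p11 (k : fieldType) (V : lmodType k) (phi : {linear V -> V})
    (fp : finite_potent phi) (m : nat) (index_phi : fp_index fp = m)
    (S : nat -> Type)
    (S_mu : forall i : nat, (1 <= i <= m)%N -> has_dim (mu_space fp i) (S i)) :
  exists F : {linear V -> V} ->
      (forall i : nat, (1 <= i <= m)%N -> S i ->
        quotmod (kermod phi) * ('I_i.-1 -> {v : V | v \in kermod phi})),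
    set_bij (X_GD1 fp) setT F.
Proof.
subst m; set m := fp_index fp in S_mu *.
(* The zero family for [i] outside 1..m is a placeholder that makes [e] total. *)
have eP i : exists e : S i -> V,
    (1 <= i <= m)%N -> injective e /\ chain_heads fp i (range e).
  case: (boolP (1 <= i <= m)%N) => [im|_]; last by exists (fun=> 0).
  by have [e ? ?] := has_dim_heads (S_mu i im); exists e.
pose e i := sval (cid (eP i)).
have e_inj i : (1 <= i <= m)%N -> injective (e i).
  by move=> /(svalP (cid (eP i)))[].
have eE i : (1 <= i <= m)%N -> chain_heads fp i (range (e i)).
  by move=> /(svalP (cid (eP i)))[].
pose E i := range (e i).
pose J := jordan_pos fp E; pose b := jordan_vec phi.
have bS i j x : phi (b (i, j, x)) = b (i, j.+1, x) by [].
have b_last i j x : J (i, j, x) -> (i <= j.+1)%N -> phi (b (i, j, x)) = 0.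
  by move=> /(jordan_head_ker eE)/iter_kerU xK ij; rewrite bS /b/jordan_vec xK.
pose ker0 : {v : V | v \in kermod phi} := exist _ 0 (rpred0 _).
(* For [psi] in [X_GD1] the differences lie in ker phi, because [phi psi phi = phi]; the default
   [ker0] is reached only for other maps. As j < i - 1, position j + 1 is still in the chain. *)
pose F (psi : {linear V -> V}) i (hi : (1 <= i <= m)%N) (s : S i) :
    quotmod (kermod phi) * ('I_i.-1 -> {v : V | v \in kermod phi}) :=
  ((\pi_(quotmod (kermod phi)) (psi (e i s)))%qT,
   fun j : 'I_i.-1 => insubd ker0 (psi (b (i, j.+1, e i s)) - b (i, j : nat, e i s))).
exists F; split=> //.
- move=> psi psi'; rewrite !inE => /X_GD1P[psi1 psi2 psiW] /X_GD1P[psi1' psi2' psiW'] FE.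
  have FE1 i hi s : F psi i hi s = F psi' i hi s by rewrite FE.
  have inK (f : {linear V -> V}) i j x : phi \o f \o phi =1 phi ->
      f (b (i, j.+1, x)) - b (i, j, x) \in kermod phi.
    by move=> f1; rewrite inE linearB/= -bS (f1 _ : phi (f (phi _)) = _) subrr.
  (* The second coordinates determine [psi] on the range of [phi]. *)
  have imE : psi \o phi =1 psi' \o phi.
    apply: (jordan_linear_ext eE) => [w wW|[[i j] x] pP] /=.
      by rewrite psiW ?psiW'.
    have [/= im ji [s _ sE]] := pP; subst x.
    have [ij|ji1] := leqP i j.+1; first by rewrite (b_last _ _ _ pP ij) !linear0.
    have hi : (1 <= i <= m)%N by rewrite im andbT; lia.
    have ji2 : (j < i.-1)%N by lia.
    have := congr1 (fun g => val (g.2 (Ordinal ji2))) (FE1 i hi s).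
    by rewrite /= !insubdK ?inK// => /addIr.
  apply: linear_ext; apply: (jordan_linear_ext eE) => [w wW|[[i [|j]] x] pP].
  + by have [w' w'W <-] := AST_surj wW; exact: imE.
  + have [/= im ji [s _ sE]] := pP; subst x.
    have hi : (1 <= i <= m)%N by rewrite im andbT.
    have /quotmod_eq := congr1 fst (FE1 i hi s).
    rewrite inE linearB subr_eq0 => /eqP/= phiE.
    (* At a head, psi e = psi (phi (psi e)), where phi (psi e) depends only on the class of psi e
       modulo ker phi. *)
    rewrite -[LHS]psi2 -[RHS]psi2'/=.
    by rewrite (imE _ : psi (phi _) = psi' (phi _)) /b/jordan_vec/= phiE.
  + exact: (imE (b (i, j, x))).
- move=> G _.
  (* The data [G] are reindexed by the heads themselves, which injectivity of [e] permits. *)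
  have gP i x : exists g : quotmod (kermod phi) * ('I_i.-1 -> {v : V | v \in kermod phi}),
      forall hi s, e i s = x -> G i hi s = g.
    have [[hi [s sx]]|no] := pselect (exists (hi : (1 <= i <= m)%N) s, e i s = x).
      exists (G i hi s) => hi' s' sx'; rewrite (bool_irrelevance hi' hi).
      by congr (G i hi _); apply: (e_inj i hi); rewrite sx'.
    exists (0, fun=> ker0) => hi s sx; exfalso; apply: no; by exists hi, s.
  pose g i x := sval (cid (gP i x)).
  have gE i hi s : g i (e i s) = G i hi s.
    by rewrite (svalP (cid (gP i (e i s))) hi s).
  (* First a {1}-inverse [h] with the prescribed second coordinates. Its value 0 at heads is
     provisional; the other 0 occurs only off the chain. *)
  pose f (p : nat * nat * V) : V := let: (i, j, x) := p in
    if j is j'.+1 then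
      if insub j' is Some o then b (i, j', x) + val ((g i x).2 o) else 0
    else 0.
  have [h [hW hJ]] := jordan_extend eE f.
  have hS i s (o : 'I_i.-1) (hi : (1 <= i <= m)%N) :
      h (b (i, o.+1, e i s)) = b (i, o : nat, e i s) + val ((G i hi s).2 o).
    rewrite hJ /=.
      case: insubP => [o' _ /val_inj->|]; first by rewrite (gE i hi).
      by rewrite ltn_ord.
    by split; [case/andP: hi| have := ltn_ord o; rewrite /=; lia| exists s].
  have h1 : phi \o h \o phi =1 phi.
    apply: (jordan_linear_ext eE) => [w wW|[[i j] x] pP] /=; first by rewrite hW.
    have [/= im ji [s _ sE]] := pP; subst x.
    have [ij|ji1] := leqP i j.+1; first by rewrite (b_last _ _ _ pP ij) !linear0.
    have hi : (1 <= i <= m)%N by rewrite im andbT; lia.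
    have ji2 : (j < i.-1)%N by lia.
    rewrite bS (hS i s (Ordinal ji2) hi) linearD/=.
    by have /eqP-> := svalP ((G i hi s).2 (Ordinal ji2)); rewrite addr0.
  (* Heads are now sent to h (phi r), with r a representative of the prescribed class. This stays in
     the class of r since [phi h phi = phi], and being a value of [h phi] it is fixed by [psi phi],
     as [psi phi psi = psi] requires. *)
  pose f' (p : nat * nat * V) : V := let: (i, j, x) := p in
    if j is j'.+1 then h (b p) else h (phi (repr (g i x).1)).
  have [psi [psiW psiJ]] := jordan_extend eE f'.
  have psi_im : psi \o phi =1 h \o phi.
    apply: (jordan_linear_ext eE) => [w wW|[[i j] x] pP] /=.
      by rewrite hW ?psiW.
    have [ij|ji1] := leqP i j.+1; first by rewrite (b_last _ _ _ pP ij) !linear0.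
    by rewrite bS psiJ//; case: pP.
  have psiphi v : psi (phi v) = h (phi v) by exact: psi_im.
  have hphi v : phi (h (phi v)) = phi v by exact: h1.
  have psi_head i s (hi : (1 <= i <= m)%N) :
      psi (e i s) = h (phi (repr (G i hi s).1)).
    rewrite -(gE i hi) -[LHS]/(psi (b (i, 0, e i s))) psiJ//.
    by case/andP: hi; split=> //; exists s.
  exists psi; last first.
    apply: functional_extensionality_dep => i.
    apply: functional_extensionality_dep => hi.
    apply/funext => s; rewrite [RHS]surjective_pairing /F; congr pair.
      rewrite (psi_head i s hi) -[RHS]reprK; apply/quotmod_eq.
      by rewrite inE linearB hphi subrr.
    apply/funext => o; apply: val_inj.
    by rewrite -bS psiphi bS (hS i s o hi) addrC addKr valKd.
  apply/X_GD1P; split=> // [v|]; first by rewrite /= psiphi hphi.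
  (* Vectors of [W] and non-heads are in the range of [phi], where [psi] agrees with [h]; only heads
     use the choice made in [f']. *)
  apply: (jordan_linear_ext eE) => [w wW|[[i [|j]] x] pP] /=.
  + by have [w' w'W <-] := AST_surj wW; rewrite !psiphi !hphi.
  + have [/= im ji [s _ sE]] := pP; subst x.
    have hi : (1 <= i <= m)%N by rewrite im andbT.
    by rewrite /b/jordan_vec/= (psi_head i s hi) psiphi !hphi.
  + by rewrite -[jordan_vec _ _]/(phi (b (i, j, x))) !psiphi !hphi.
Qed.
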